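(* Let $A\in\mathbb{R}^{n\times n}$ be symmetric positive definite with largest eigenvalue $\lambda_{\max}$, and let $A_{\mathcal H}\in\mathbb{R}^{n\times n}$ be a symmetric matrix. Let $S_1,\dots,S_N$ be nonzero linear subspaces of $\mathbb{R}^n$ and $\epsilon_1,\dots,\epsilon_N\ge 0$ real numbers such that: (A1) $\mathbb{R}^n=S_1\oplus S_2\oplus\cdots\oplus S_N$, and the $S_i$ are $A$-orthogonal, i.e. for all $i\neq j$, $v_i^TAv_j=0$ for all $v_i\in S_i$ and $v_j\in S_j$; (A2) for every $i$, $\|(A-A_{\mathcal H})v\|\le \epsilon_i\|A\|\,\|v\|$ for all $v\in S_i$. For $1\le i\le N$ let $P_i=S_i\oplus\cdots\oplus S_N$ and $$\mu_i=\min_{v\in P_i,\ v\neq 0}\frac{(Av,v)}{(v,v)}.$$ Assume moreover that $$\frac{\epsilon_N\lambda_{\max}}{\mu_N}+\frac{2}{\sqrt3}\sum_{i<N}\frac{\epsilon_i\lambda_{\max}}{\mu_i}<1 .$$ Then $$\kappa(A_{\mathcal H}^{-1}A)\le \frac{1+\epsilon_N\lambda_{\max}/\mu_N+\frac{2}{\sqrt3}\sum_{i<N}\epsilon_i\lambda_{\max}/\mu_i}{1-\epsilon_N\lambda_{\max}/\mu_N-\frac{2}{\sqrt3}\sum_{i<N}\epsilon_i\lambda_{\max}/\mu_i}.$$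
   Context: $(\cdot,\cdot)$ is the Euclidean inner product on $\mathbb{R}^n$, $\|\cdot\|$ is the Euclidean norm for vectors and the induced operator norm for matrices (so $\|A\|=\lambda_{\max}$). The condition number $\kappa$ is the ratio of extreme eigenvalues: $\kappa(A_{\mathcal H}^{-1}A)=\lambda_{\max}(A_{\mathcal H}^{-1}A)/\lambda_{\min}(A_{\mathcal H}^{-1}A)$. *)

(* Defs.v *)
(* MathComp / MathComp-Analysis; vectors of R^n are columns 'cV[R]_n. *)
From mathcomp Require Import all_boot all_order all_algebra.
From mathcomp Require Import all_classical all_reals.

Set Implicit Arguments.
Unset Strict Implicit.
Unset Printing Implicit Defensive.

Import Order.TTheory GRing.Theory Num.Theory.

Local Open Scope classical_set_scope.
Local Open Scope ring_scope.

Section Extrema.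
Variables (R : realType).

(* Attained extrema, as opposed to [inf] and [sup]. *)
Definition is_min (E : set R) (m : R) : Prop := E m /\ lbound E m.
Definition is_max (E : set R) (m : R) : Prop := E m /\ ubound E m.

End Extrema.

Section Euclidean.
Variables (R : realType) (n : nat).
Implicit Types (u v : 'cV[R]_n) (A M : 'M[R]_n).

Definition dotp u v : R := \sum_(k < n) u k 0 * v k 0.

Definition enorm v : R := Num.sqrt (dotp v v).

Definition opnorm M : R := sup [set enorm (M *m v) | v in [set v | enorm v <= 1]].

Definition spd A : Prop := A^T = A /\ forall v, v != 0 -> 0 < dotp (A *m v) v.

Definition rayleigh A v : R := dotp (A *m v) v / dotp v v.

(* [eigenvalue M] is defined through row vectors (v *m M = a *: v); a square
   matrix and its transpose have the same eigenvalues. *)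
Definition spectrum M : set R := [set a | eigenvalue M a].

(* The condition number as a relation, so that its existence is part of any
   claim about it. The spectrum here is the real one, which is the whole
   spectrum for a product of a symmetric matrix and an spd one. *)
Definition is_condition_number M (k : R) : Prop :=
  exists lmin lmax, [/\ is_min (spectrum M) lmin, is_max (spectrum M) lmax
                      & k = lmax / lmin].

(* The subspaces are S 0, ..., S N, so there is always a last one. *)
Definition tail_space (N : nat) (S : 'I_N.+1 -> {vspace 'cV[R]_n})
    (i : 'I_N.+1) : {vspace 'cV[R]_n} :=
  (\sum_(j < N.+1 | (i <= j)%N) S j)%VS.

End Euclidean.

(* Main.v *)
Require Import Defs.
From mathcomp Require Import all_boot all_order all_algebra.
From mathcomp Require Import all_classical all_reals.
From mathcomp Require Import ring lra.

(** Put E = A - AH. Everything follows from the relative bound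
    |(E v, v)| <= delta (A v, v) for all v ([perturbation_le]). Since
    delta < 1, it makes AH positive definite and confines each quotient
    (A v, v) / (AH v, v) to the interval from 1 / (1 + delta) to
    1 / (1 - delta); the eigenvalues of AH^-1 A are among these quotients.

    To get the bound, decompose v as a sum of v_i in S_i and let w_i be the
    tail v_i + ... + v_N. As E is symmetric, the double sum of (E v_i, v_j)
    can be folded along its diagonal:
      (E v, v) = sum over i of (E v_i, 2 w_i - v_i).
    Both v_i and 2 w_i - v_i lie in P_i, where the Euclidean norm is at most
    mu_i^(-1/2) times the energy norm, so that the bound
    |E v_i| <= eps_i lmax |v_i| and Cauchy-Schwarz give
      |(E v_i, 2 w_i - v_i)|
        <= (eps_i lmax / mu_i) * sqrt (|v_i|_A^2 * |2 w_i - v_i|_A^2).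
    A-orthogonality gives, with a = |v_i|_A^2 and b = |w_i|_A^2 <= |v|_A^2,
    the value 4 b - 3 a for |2 w_i - v_i|_A^2, and a (4 b - 3 a) is at most
    4/3 b^2: this is the constant 2 / sqrt 3. In the last term
    2 w_N - v_N = v_N, and the constant is 1.

    Two spectral facts are also needed: ||A|| <= lmax, and the real spectrum
    of AH^-1 A is nonempty and has extreme elements. Both come from a single
    variational statement ([geigen_max]): for B symmetric and C positive
    definite, the supremum s of (B v, v) / (C v, v) is an eigenvalue of
    C^-1 B. Indeed s C - B is positive semidefinite; were it invertible, it
    would be bounded below by a multiple of the identity
    ([psd_unit_coercive]), and s could be decreased. *)

Set Implicit Arguments.
Unset Strict Implicit.
Unset Printing Implicit Defensive.

Import Order.TTheory GRing.Theory Num.Theory.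

Local Open Scope classical_set_scope.
Local Open Scope ring_scope.

(** * The Euclidean inner product and quadratic forms *)

Section DotProduct.
Variables (R : realType) (n : nat).
Implicit Types (u v w : 'cV[R]_n) (T B C M : 'M[R]_n).

Lemma dotpE u v : dotp u v = (u^T *m v) 0 0.
Proof. by rewrite mxE; apply: eq_bigr => k _; rewrite mxE. Qed.

Lemma dotpC u v : dotp u v = dotp v u.
Proof. by apply: eq_bigr => k _; rewrite mulrC. Qed.

Lemma dotpDl u v w : dotp (u + v) w = dotp u w + dotp v w.
Proof. by rewrite -big_split; apply: eq_bigr => k _; rewrite mxE mulrDl. Qed.

Lemma dotpZl a u v : dotp (a *: u) v = a * dotp u v.
Proof. by rewrite mulr_sumr; apply: eq_bigr => k _; rewrite mxE mulrA. Qed.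

Lemma dotpDr u v w : dotp u (v + w) = dotp u v + dotp u w.
Proof. by rewrite dotpC dotpDl 2![dotp _ u]dotpC. Qed.

Lemma dotpZr a u v : dotp u (a *: v) = a * dotp u v.
Proof. by rewrite dotpC dotpZl dotpC. Qed.

Lemma dotp0l v : dotp 0 v = 0.
Proof. by rewrite -(scale0r 0) dotpZl mul0r. Qed.

Lemma dotpNl u v : dotp (- u) v = - dotp u v.
Proof. by rewrite -scaleN1r dotpZl mulN1r. Qed.

Lemma dotp_suml (I : Type) (r : seq I) (P : pred I) (F : I -> 'cV[R]_n) v :
  dotp (\sum_(i <- r | P i) F i) v = \sum_(i <- r | P i) dotp (F i) v.
Proof. exact: (big_morph (fun u => dotp u v) (fun x y => dotpDl x y v) (dotp0l v)). Qed.

Lemma dotp_sumr (I : Type) (r : seq I) (P : pred I) (F : I -> 'cV[R]_n) v :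
  dotp v (\sum_(i <- r | P i) F i) = \sum_(i <- r | P i) dotp v (F i).
Proof. by rewrite dotpC dotp_suml; apply: eq_bigr => i _; rewrite dotpC. Qed.

Lemma dotp_sym T u v : T^T = T -> dotp (T *m u) v = dotp (T *m v) u.
Proof. by move=> Tt; rewrite [RHS]dotpC !dotpE trmx_mul Tt mulmxA. Qed.

Lemma dotp_ge0 v : 0 <= dotp v v.
Proof. by apply: sumr_ge0 => k _; rewrite -expr2 sqr_ge0. Qed.

Lemma dotp_eq0 v : (dotp v v == 0) = (v == 0).
Proof.
apply/eqP/eqP => [|->]; last exact: dotp0l.
move/psumr_eq0P => v0; apply/colP => k; rewrite mxE.
have /eqP := v0 (fun k _ => sqr_ge0 (v k 0)) k isT.
by rewrite mulf_eq0 orbb => /eqP.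
Qed.

Lemma dotp_gt0 v : v != 0 -> 0 < dotp v v.
Proof. by move=> v0; rewrite lt_neqAle dotp_ge0 eq_sym dotp_eq0 v0. Qed.

Lemma enorm_sqr v : enorm v ^+ 2 = dotp v v.
Proof. by rewrite sqr_sqrtr ?dotp_ge0. Qed.

Lemma enorm_ge0 v : 0 <= enorm v.
Proof. exact: sqrtr_ge0. Qed.

Lemma quadD T u v (x y : R) : T^T = T ->
  dotp (T *m (x *: u + y *: v)) (x *: u + y *: v)
  = x ^+ 2 * dotp (T *m u) u + 2 * x * y * dotp (T *m u) v
    + y ^+ 2 * dotp (T *m v) v.
Proof.
move=> Tt; rewrite mulmxDr -!scalemxAr !(dotpDl, dotpDr, dotpZl, dotpZr).
by rewrite (dotp_sym v u Tt); ring.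
Qed.

(** Semidefinite forms are allowed because the lemma is applied to s C - B,
    which turns out to be singular. *)
Lemma cauchy_schwarz_psd T u v : T^T = T ->
  (forall w, 0 <= dotp (T *m w) w) ->
  dotp (T *m u) v ^+ 2 <= dotp (T *m u) u * dotp (T *m v) v.
Proof.
move=> Tt T0; set b := dotp _ v; set a := dotp _ u; set c := dotp _ v.
have a0 : 0 <= a by exact: T0.
have q x y : 0 <= x ^+ 2 * a + 2 * x * y * b + y ^+ 2 * c.
  by have := T0 (x *: u + y *: v); rewrite quadD.
have : 0 <= c by exact: T0.
rewrite le_eqVlt => /orP[/eqP c0 | c0]; last first.
  (* For x = c, the value of the form at x u + y v is least when y = - b. *)
  have := q c (- b).
  have -> : c ^+ 2 * a + 2 * c * (- b) * b + (- b) ^+ 2 * c = (a * c - b ^+ 2) * c.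
    by ring.
  by rewrite pmulr_lge0 // subr_ge0.
rewrite -c0 mulr0; have [-> | b0] := eqVneq b 0; first by rewrite expr0n.
(* With c = 0 the form is affine along the line u + y v: this y would make
   it equal to - a - 2, hence negative. *)
have := q 1 (- (a + 1) / (2 * b) * 2); rewrite -c0.
have -> : 2 * 1 * (- (a + 1) / (2 * b) * 2) * b = - (2 * (a + 1)).
  by field.
rewrite expr1n mul1r mulr0 addr0; lra.
Qed.

Lemma cauchy_schwarz u v : dotp u v ^+ 2 <= dotp u u * dotp v v.
Proof.
have := @cauchy_schwarz_psd 1%:M u v (trmx1 _ _).
by rewrite !mul1mx; apply => w; rewrite mul1mx dotp_ge0.
Qed.

Lemma quad_bounded M :
  exists2 K : R, 0 < K & forall v, `|dotp (M *m v) v| <= K * dotp v v.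
Proof.
exists (1 + \sum_i \sum_j `|M i j|) => [|v].
  by apply: ltr_pwDl => //; do 2![apply: sumr_ge0 => ? _].
rewrite mulrDl mul1r; apply: le_trans (_ : _ <= (\sum_i \sum_j `|M i j|) * dotp v v) _;
  last by rewrite lerDr dotp_ge0.
rewrite mulr_suml; apply: le_trans (ler_norm_sum _ _ _) _.
apply: ler_sum => i _; rewrite mxE !mulr_suml.
apply: le_trans (ler_norm_sum _ _ _) _; apply: ler_sum => j _.
rewrite -mulrA normrM ler_wpM2l //.
have le k : v k 0 ^+ 2 <= dotp v v.
  rewrite /dotp (bigD1 k) //= -expr2 lerDl.
  by apply: sumr_ge0 => ? _; rewrite -expr2 sqr_ge0.
rewrite -ler_sqr ?nnegrE ?dotp_ge0 // normrM exprMn !real_normK ?num_real //.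
by rewrite [leRHS]expr2 ler_pM ?sqr_ge0.
Qed.

(** Cauchy-Schwarz for T, applied to T^-1 v and v, reads
    (v, v)^2 <= (T^-1 v, v) (T v, v), and (T^-1 v, v) is bounded by a multiple
    of (v, v). No smallest eigenvalue of T and no compactness of the sphere
    are involved. *)
Lemma psd_unit_coercive T : T^T = T -> (forall v, 0 <= dotp (T *m v) v) ->
  T \in unitmx -> exists2 c : R, 0 < c & forall v, c * dotp v v <= dotp (T *m v) v.
Proof.
move=> Tt T0 Tu; have [K K0 hK] := quad_bounded (invmx T).
exists K^-1 => [|v]; first by rewrite invr_gt0.
rewrite ler_pdivrMl //; have [->|v0] := eqVneq v 0.
  by rewrite mulmx0 dotp0l mulr0.
have vv := dotp_gt0 v0; rewrite -(ler_pM2l vv) -expr2.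
have := cauchy_schwarz_psd (invmx T *m v) v Tt T0; rewrite mulKVmx // => h.
apply: le_trans h _; rewrite mulrA [_ * K]mulrC ler_wpM2r // dotpC.
exact: le_trans (ler_norm _) (hK v).
Qed.

(** * Extremal generalized eigenvalues *)

Lemma unitmx_kerP T : reflect (exists2 v : 'cV[R]_n, v != 0 & T *m v = 0)
  (T \notin unitmx).
Proof.
apply: (iffP idP) => [|[v v0 Tv]]; last first.
  apply/negP => Tu; case/negP: v0; apply/eqP.
  by rewrite -(mulKmx Tu v) Tv mulmx0.
rewrite -unitmx_tr -row_free_unit -kermx_eq0 => /rowV0Pn[w /sub_kermxP wT w0].
exists w^T; first by rewrite trmx_eq0.
by apply: trmx_inj; rewrite trmx_mul trmxK wT trmx0.
Qed.

Lemma eigenvalueP_col M a : reflect (exists2 v : 'cV[R]_n, v != 0 & M *m v = a *: v)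
  (eigenvalue M a).
Proof.
rewrite /eigenvalue kermx_eq0 row_free_unit.
apply: (iffP (unitmx_kerP _)) => -[v v0 e]; exists v => //; move: e.
  by rewrite mulmxBl mul_scalar_mx => /subr0_eq.
by rewrite mulmxBl mul_scalar_mx => ->; rewrite subrr.
Qed.

Lemma spd_unitmx C : spd C -> C \in unitmx.
Proof.
move=> [_ C0]; apply/negbNE/negP => /unitmx_kerP[v v0 Cv].
by have := C0 v v0; rewrite Cv dotp0l ltxx.
Qed.

Lemma spd_ge0 C v : spd C -> 0 <= dotp (C *m v) v.
Proof.
move=> [_ C0]; have [->|/C0/ltW//] := eqVneq v 0; by rewrite mulmx0 dotp0l.
Qed.

(** The largest generalized eigenvalue of the pencil (B, C) is the maximum of
    its Rayleigh quotient. The same statement for - B gives the smallest one,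
    and C = 1 gives the largest eigenvalue of B. *)
Lemma geigen_max B C : (0 < n)%N -> B^T = B -> spd C ->
  exists2 s, eigenvalue (invmx C *m B) s
           & forall v, dotp (B *m v) v <= s * dotp (C *m v) v.
Proof.
move=> n0 Bt sC; have Cu := spd_unitmx sC; have [Ct C0] := sC.
have [c c0 hc] := psd_unit_coercive Ct (fun v => spd_ge0 v sC) Cu.
have [K K0 hK] := quad_bounded B; have [L L0 hL] := quad_bounded C.
pose E := [set dotp (B *m v) v / dotp (C *m v) v | v in [set v | v != 0]].
have E0 : E !=set0.
  exists (dotp (B *m const_mx 1) (const_mx 1) / dotp (C *m const_mx 1) (const_mx 1)).
  exists (const_mx 1) => //=; apply/eqP => /colP /(_ (Ordinal n0)).
  by rewrite !mxE => /eqP; rewrite oner_eq0.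
have Eub : has_ubound E.
  exists (K / c) => _ [v v0 <-]; rewrite ler_pdivrMr ?C0 //.
  apply: le_trans (ler_norm _) (le_trans (hK v) _).
  by rewrite -mulrA ler_pM2l // ler_pdivlMl.
have le_sup v : dotp (B *m v) v <= sup E * dotp (C *m v) v.
  have [->|v0] := eqVneq v 0; first by rewrite !mulmx0 dotp0l mulr0.
  by rewrite -ler_pdivrMr ?C0 //; apply: ub_le_sup => //; exists v.
exists (sup E) => //; set s := sup E in le_sup *.
pose T := s *: C - B.
have TE v : dotp (T *m v) v = s * dotp (C *m v) v - dotp (B *m v) v.
  by rewrite mulmxBl -scalemxAl dotpDl dotpZl dotpNl.
have Tt : T^T = T by rewrite linearB linearZ /= Ct Bt.
have T0 v : 0 <= dotp (T *m v) v by rewrite TE subr_ge0.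
have /unitmx_kerP[v v0] : T \notin unitmx.
  apply/negP => /(psd_unit_coercive Tt T0)[d d0 hd].
  (* (T v, v) >= d (v, v) >= (d / L) (C v, v) makes s - d / L an upper bound. *)
  suff : s <= s - d / L by rewrite lerDl oppr_ge0 leNgt divr_gt0.
  apply: sup_le_ub => // _ [v v0 <-]; rewrite ler_pdivrMr ?C0 //.
  have := hd v; rewrite TE.
  have : d / L * dotp (C *m v) v <= d * dotp v v.
    rewrite -mulrA ler_pM2l // ler_pdivrMl //.
    exact: le_trans (ler_norm _) (hL v).
  by lra.
rewrite mulmxBl -scalemxAl => /subr0_eq sCB.
by apply/eigenvalueP_col; exists v; rewrite // -mulmxA -sCB -scalemxAr mulKmx.
Qed.

End DotProduct.

Section Perturbation.
Variables (R : realType) (n : nat).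
Implicit Types (u v w x y : 'cV[R]_n) (A B E : 'M[R]_n).

Lemma spectrum_max_gt0 A l : spd A -> is_max (spectrum A) l -> 0 < l.
Proof.
move=> [_ A0] [/eigenvalueP_col[v v0 Av] _].
by have := A0 v v0; rewrite Av dotpZl pmulr_lgt0 // dotp_gt0.
Qed.

Lemma spectrum_dim_gt0 A a : spectrum A a -> (0 < n)%N.
Proof.
move=> /eigenvalueP_col[v v0 _]; rewrite lt0n; apply/negP => /eqP n0.
case/negP: v0; apply/eqP/colP => k; exfalso.
by have := ltn_ord k; rewrite [X in (_ < X)%N]n0.
Qed.

Lemma spd1 : spd (1%:M : 'M[R]_n).
Proof. by split=> [|v v0]; rewrite ?trmx1 // mul1mx dotp_gt0. Qed.

(** From (A v, v) <= l (v, v), Cauchy-Schwarz for the form of A, applied to v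
    and w = A v, gives (w, w)^2 <= (A v, v) (A w, w) <= l^2 (v, v) (w, w). *)
Lemma spd_mulmx_le A l : spd A -> is_max (spectrum A) l ->
  forall v, dotp (A *m v) (A *m v) <= l ^+ 2 * dotp v v.
Proof.
move=> sA hl; have l0 := spectrum_max_gt0 sA hl; have [At _] := sA.
have [s] := geigen_max (spectrum_dim_gt0 hl.1) At spd1.
rewrite invmx1 mul1mx => /hl.2 sl hs.
have {}hs v : dotp (A *m v) v <= l * dotp v v.
  by apply: le_trans (hs v) _; rewrite mul1mx ler_wpM2r ?dotp_ge0.
move=> v; set w := A *m v.
have [->|w0] := eqVneq w 0; first by rewrite dotp0l mulr_ge0 ?sqr_ge0 ?dotp_ge0.
rewrite -(ler_pM2r (dotp_gt0 w0)) -expr2.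
apply: le_trans (cauchy_schwarz_psd v w At (fun x => spd_ge0 x sA)) _.
have -> : l ^+ 2 * dotp v v * dotp w w = (l * dotp v v) * (l * dotp w w) by ring.
by apply: ler_pM; rewrite ?spd_ge0 ?hs.
Qed.

Lemma opnorm_le A l : spd A -> is_max (spectrum A) l -> opnorm A <= l.
Proof.
move=> sA hl; have l0 := ltW (spectrum_max_gt0 sA hl).
apply: sup_le_ub => [|_ [v /= v1 <-]].
  exists (enorm (A *m 0)), 0 => //=.
  by rewrite /enorm dotp0l sqrtr0.
rewrite -ler_sqr ?nnegrE ?enorm_ge0 // enorm_sqr.
apply: le_trans (spd_mulmx_le sA hl v) _.
rewrite -enorm_sqr -exprMn ler_sqr ?nnegrE ?mulr_ge0 ?enorm_ge0 //.
by rewrite ler_piMr.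
Qed.

(** The relative bound amounts to (1 - d) A <= B <= (1 + d) A as forms. On an
    eigenvector of B^-1 A for a, (A v, v) = a (B v, v), so that
    a (1 - d) <= 1 <= a (1 + d). *)
Lemma condition_number_le A B (d : R) : (0 < n)%N -> spd A -> B^T = B -> d < 1 ->
  (forall v, `|dotp ((A - B) *m v) v| <= d * dotp (A *m v) v) ->
  B \in unitmx /\
  exists2 k, is_condition_number (invmx B *m A) k & k <= (1 + d) / (1 - d).
Proof.
move=> n0 sA Bt d1 hd; have [At A0] := sA.
have {}hd v : (1 - d) * dotp (A *m v) v <= dotp (B *m v) v <= (1 + d) * dotp (A *m v) v.
  by have := hd v; rewrite mulmxBl dotpDl dotpNl ler_norml; lra.
have sB : spd B.
  split=> // v v0; have /andP[+ _] := hd v; apply: lt_le_trans.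
  by rewrite mulr_gt0 ?A0 // subr_gt0.
have Bu := spd_unitmx sB; split=> //.
have eig a : spectrum (invmx B *m A) a ->
    exists2 v, v != 0 & dotp (A *m v) v = a * dotp (B *m v) v.
  move=> /eigenvalueP_col[v v0 e]; exists v => //.
  by rewrite -dotpZl scalemxAr -e -mulmxA mulKVmx.
have [s s_eig s_ub] := geigen_max n0 At sB.
have [r r_eig r_ub] : exists2 r, spectrum (invmx B *m A) r
    & forall v, r * dotp (B *m v) v <= dotp (A *m v) v.
  have [|r r_eig r_ub] := @geigen_max R n (- A) B n0 _ sB; first by rewrite linearN /= At.
  exists (- r) => [|v]; last first.
    by have := r_ub v; rewrite mulNmx dotpNl mulNr lerNl.
  have /eigenvalueP_col[v v0 e] := r_eig; apply/eigenvalueP_col; exists v => //.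
  by rewrite scaleNr -e mulmxN mulNmx opprK.
exists (s / r); first exists r, s.
  split=> //; split=> // a /eig[v v0 e]; have [_ /(_ v v0) Bv] := sB.
    by rewrite -(ler_pM2r Bv) -e.
  by rewrite -(ler_pM2r Bv) -e.
have [v v0 ev] := eig _ r_eig; have [w w0 ew] := eig _ s_eig.
have [_ B0] := sB.
have r0 : 0 < r by rewrite -(pmulr_lgt0 _ (B0 _ v0)) -ev A0.
have s0 : 0 < s by rewrite -(pmulr_lgt0 _ (B0 _ w0)) -ew A0.
have rd : 1 <= r * (1 + d).
  have /andP[_] := hd v; rewrite ev mulrCA mulrA -[leLHS]mul1r.
  by rewrite ler_pM2r ?B0 // mulrC.
have sd : s * (1 - d) <= 1.
  have /andP[+ _] := hd w; rewrite ew mulrA -[leRHS]mul1r.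
  by rewrite ler_pM2r ?B0 // mulrC.
have d1' : 0 < 1 - d by rewrite subr_gt0.
rewrite ler_pdivrMr // mulrAC ler_pdivlMr //.
by apply: le_trans sd _; rewrite mulrC.
Qed.

(** * Perturbations small on the summands of an orthogonal decomposition *)

Lemma cross_term_le A E x y (e m c Q : R) : 0 <= e -> 0 < m -> 0 <= c -> 0 <= Q ->
  dotp (E *m x) (E *m x) <= e ^+ 2 * dotp x x ->
  m * dotp x x <= dotp (A *m x) x -> m * dotp y y <= dotp (A *m y) y ->
  dotp (A *m x) x * dotp (A *m y) y <= (c * Q) ^+ 2 ->
  `|dotp (E *m x) y| <= c * (e / m) * Q.
Proof.
move=> e0 m0 c0 Q0 hE hx hy hxy.
have em0 : 0 <= e / m by rewrite divr_ge0 // ltW.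
rewrite -ler_sqr ?nnegrE ?(mulr_ge0 (mulr_ge0 c0 em0) Q0) // real_normK ?num_real //.
apply: le_trans (cauchy_schwarz _ _) _.
apply: le_trans (ler_wpM2r (dotp_ge0 y) hE) _.
have -> : (c * (e / m) * Q) ^+ 2 = (e / m) ^+ 2 * (c * Q) ^+ 2 by ring.
rewrite expr_div_n -[leRHS]mulrA -mulrA ler_wpM2l ?sqr_ge0 // ler_pdivlMl ?exprn_gt0 //.
apply: le_trans hxy; rewrite expr2 mulrACA.
by apply: ler_pM; rewrite ?mulr_ge0 ?dotp_ge0 // ltW.
Qed.

(** The part of the square below the diagonal is the mirror image of the part
    above; 2 times the upper part, diagonal included, counts the diagonal
    twice. *)
Lemma sum_sym_tail N (f : 'I_N -> 'I_N -> R) : (forall i j, f i j = f j i) ->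
  \sum_i \sum_j f i j = \sum_(i < N) (2 * (\sum_(j < N | (i <= j)%N) f i j) - f i i).
Proof.
move=> fs.
under eq_bigr => i _ do rewrite (bigID (fun j : 'I_N => (i <= j)%N)) /=.
rewrite big_split /=.
have -> : \sum_(i < N) \sum_(j < N | ~~ (i <= j)%N) f i j
          = \sum_(i < N) (\sum_(j < N | (i <= j)%N) f i j - f i i).
  rewrite (exchange_big_dep xpredT) //=; apply: eq_bigr => i _.
  rewrite [X in _ = X - _](bigD1 i) //= [X in X - _]addrC addrK.
  by apply: eq_big => [j|j _] //; rewrite -ltnNge ltn_neqAle andbC eq_sym.
by rewrite -big_split; apply: eq_bigr => i _ /=; ring.
Qed.

(** The bound is relative to the energy (A v, v), although E is controlled in
    the Euclidean norm only: a vector of the i-th summand is paired only with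
    vectors of the i-th tail, where the two norms compare with constant mu i,
    and not with the smallest eigenvalue of A. *)
Lemma perturbation_le N A E (S : 'I_N.+1 -> {vspace 'cV[R]_n})
    (e mu : 'I_N.+1 -> R) : spd A -> E^T = E ->
  (\sum_i S i)%VS = fullv ->
  (forall i j, i != j -> forall u v, u \in S i -> v \in S j -> dotp (A *m u) v = 0) ->
  (forall i, 0 <= e i) -> (forall i, 0 < mu i) ->
  (forall i v, v \in S i -> dotp (E *m v) (E *m v) <= e i ^+ 2 * dotp v v) ->
  (forall i v, v \in tail_space S i -> mu i * dotp v v <= dotp (A *m v) v) ->
  forall v, `|dotp (E *m v) v| <=
    (e ord_max / mu ord_max
     + 2 / Num.sqrt 3 * \sum_(i < N.+1 | (i < N)%N) e i / mu i) * dotp (A *m v) v.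
Proof.
move=> sA Et hS horth e0 mu0 hE hmu v; have [At _] := sA.
have /memv_sumP[vs vsS ->] : v \in (\sum_i S i)%VS by rewrite hS memvf.
set V := \sum_i vs i; pose q x := dotp (A *m x) x.
pose w (i : 'I_N.+1) := \sum_(j < N.+1 | (i <= j)%N) vs j.
have q0 x : 0 <= q x by exact: spd_ge0.
have vsP i : vs i \in tail_space S i.
  by apply: (subvP (sumv_sup i _ (subvv _))) (vsS i isT).
have wP i : w i \in tail_space S i by apply: memv_sumr => j _; apply: vsS.
have orth i j : i != j -> dotp (A *m vs i) (vs j) = 0.
  by move=> ij; apply: (horth i j) => //; apply: vsS.
have qsum (P : pred 'I_N.+1) : q (\sum_(i | P i) vs i) = \sum_(i | P i) q (vs i).
  rewrite /q mulmx_sumr dotp_suml; apply: eq_bigr => i Pi.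
  rewrite dotp_sumr (bigD1 i) //= big1 ?addr0 // => j /andP[_ ji].
  by rewrite orth // eq_sym.
have qw i : q (w i) <= q V.
  rewrite !qsum [leRHS](bigID (fun j : 'I_N.+1 => (i <= j)%N)) /= lerDl.
  by apply: sumr_ge0.
have vw i : dotp (A *m vs i) (w i) = q (vs i).
  rewrite dotp_sumr (bigD1 i) //= big1 ?addr0 // => j /andP[_ ji].
  by rewrite orth // eq_sym.
(* y i = v_i + 2 (v_(i+1) + ... + v_N), without reference to i + 1. *)
pose y i := 2 *: w i + (-1) *: vs i.
have yP i : y i \in tail_space S i by rewrite memvD // memvZ.
have qy i : q (y i) = 4 * q (w i) - 3 * q (vs i).
  by rewrite /q quadD // (dotp_sym (w i) (vs i) At) vw /q; ring.
have -> : dotp (E *m V) V = \sum_i dotp (E *m vs i) (y i).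
  rewrite mulmx_sumr dotp_suml.
  under eq_bigr => i _ do rewrite dotp_sumr.
  rewrite sum_sym_tail => [|i j]; last by rewrite dotp_sym.
  apply: eq_bigr => i _; rewrite dotpDr !dotpZr dotp_sumr; ring.
apply: le_trans (ler_norm_sum _ _ _) _.
rewrite (bigD1 ord_max) //= mulrDl lerD //.
  have -> : y ord_max = vs ord_max.
    have wmax : w ord_max = vs ord_max.
      rewrite /w (bigD1 ord_max) //= big1 ?addr0 // => j /andP[Nj /eqP[]].
      by apply/val_inj/anti_leq; rewrite Nj leq_ord.
    by rewrite /y wmax scaleN1r scaler_nat mulr2n addrK.
  rewrite -[e _ / _]mul1r; apply: (@cross_term_le A _ _ _ _ _ _ _ (e0 _) (mu0 _) ler01 (q0 V)
    (hE _ _ (vsS _ isT)) (hmu _ _ (vsP _)) (hmu _ _ (vsP _))).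
  rewrite mul1r -expr2 -!/(q _) ler_sqr ?nnegrE ?q0 //.
  rewrite [leRHS]qsum (bigD1 ord_max) //= lerDl; exact: sumr_ge0.
rewrite [X in _ <= X * _]mulr_sumr [leRHS]mulr_suml.
rewrite [leRHS](eq_bigl (fun i => i != ord_max)); last first.
  by move=> i; rewrite -val_eqE /= ltn_neqAle -ltnS ltn_ord andbT.
apply: ler_sum => i _.
have c0 : 0 <= 2 / Num.sqrt 3 :> R by rewrite divr_ge0 ?sqrtr_ge0.
apply: (@cross_term_le A _ _ _ _ _ _ _ (e0 _) (mu0 _) c0 (q0 V)
  (hE _ _ (vsS _ isT)) (hmu _ _ (vsP _)) (hmu _ _ (yP _))).
rewrite -!/(q _) qy exprMn expr_div_n sqr_sqrtr //.
have := qw i; have := q0 (w i); have := q0 V; set a := q (vs i); set b := q (w i).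
set c := q V => {}c0 b0 bc.
apply: (@le_trans _ _ (2 ^+ 2 / 3 * b ^+ 2)).
  (* 4/3 b^2 - a (4 b - 3 a) = (2 b - 3 a)^2 / 3 *)
  have := sqr_ge0 (2 * b - 3 * a); lra.
by rewrite ler_wpM2l ?divr_ge0 ?sqr_ge0 // ler_sqr ?nnegrE.
Qed.

End Perturbation.

Theorem theorem2 (R : realType) (n N : nat) (A AH : 'M[R]_n) (lmax : R)
    (S : 'I_N.+1 -> {vspace 'cV[R]_n}) (eps mu : 'I_N.+1 -> R)
    (hA : spd A)
    (hlmax : is_max (spectrum A) lmax)
    (hAH : AH^T = AH)
    (hS : forall i, S i != 0%VS)
    (heps : forall i, 0 <= eps i)
    (hsum : (\sum_(i < N.+1) S i)%VS = fullv)
    (hdirect : directv (\sum_(i < N.+1) S i)%VS)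
    (horth : forall i j, i != j ->
       forall u v, u \in S i -> v \in S j -> u^T *m A *m v = 0)
    (happrox : forall i v, v \in S i ->
       enorm ((A - AH) *m v) <= eps i * opnorm A * enorm v)
    (hmu : forall i,
       is_min [set rayleigh A v | v in [set v | v \in tail_space S i /\ v != 0]]
              (mu i)) :
  let delta := eps ord_max * lmax / mu ord_max
    + 2 / Num.sqrt 3 * \sum_(i < N.+1 | (i < N)%N) eps i * lmax / mu i in
  delta < 1 ->
  AH \in unitmx /\
  exists2 k, is_condition_number (invmx AH *m A) k
           & k <= (1 + delta) / (1 - delta).
Proof.
move=> delta d1; have [At A0] := hA; have l0 := spectrum_max_gt0 hA hlmax.
have mu0 i : 0 < mu i.
  have [[v [_ v0] <-] _] := hmu i.
  by rewrite divr_gt0 ?A0 ?dotp_gt0.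
apply: (condition_number_le (spectrum_dim_gt0 hlmax.1) hA hAH d1).
apply: (perturbation_le hA _ hsum _ _ mu0).
- by rewrite linearB /= At hAH.
- move=> i j ij u v uS vS.
  by rewrite dotpE trmx_mul At (horth i j ij u v uS vS) mxE.
- by move=> i; rewrite mulr_ge0 // ltW.
- move=> i v vS; rewrite -!enorm_sqr -exprMn.
  rewrite ler_sqr ?nnegrE ?mulr_ge0 ?enorm_ge0 ?(ltW l0) //.
  apply: le_trans (happrox i v vS) _.
  by rewrite ler_wpM2r ?enorm_ge0 // ler_wpM2l // opnorm_le.
- move=> i v vP; have [->|v0] := eqVneq v 0; first by rewrite mulmx0 dotp0l mulr0.
  by rewrite -ler_pdivlMr ?dotp_gt0 //; apply: (hmu i).2; exists v.
Qed.
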